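(* Let $m\ge 3$, $n\ge 2$. The number $|\mathcal{D}_n^m|$ of $m\times(n+1)$ dope matrices satisfies $$|\mathcal{D}_n^m|\le\binom{3n+m-2+(m-2)n(n+1)/2}{m+n-2},$$ and moreover this binomial coefficient is at most $\binom{mn^2}{m+n}$, which in turn is at most $2^{(m+n)\log_2(emn)}$.
   Context: For a polynomial $P\in\mathbb{C}[x]$ of degree $n$ and an $m$-tuple $\Lambda=(\lambda_1,\dots,\lambda_m)$ of distinct complex numbers, the dope matrix of $P$ with respect to $\Lambda$ is the $m\times(n+1)$ matrix $D_P(\Lambda)=(\delta_{ij})_{i\in[1,m],\,j\in[0,n]}$, where $\delta_{ij}=1$ if $P^{(j)}(\lambda_i)=0$ and $\delta_{ij}=0$ otherwise ($P^{(j)}$ denotes the $j$-th derivative). $\mathcal{D}_n^m=\{D_P(\Lambda):\deg P=n,\ \Lambda\in\mathbb{C}^m\text{ with distinct entries}\}$ is the set of all $m\times(n+1)$ dope matrices. *)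

(* Defs.v *)
From mathcomp Require Import all_boot all_order all_algebra.
From mathcomp Require Import complex.
From mathcomp Require Import boolp reals exp.

Set Implicit Arguments.
Unset Strict Implicit.
Unset Printing Implicit Defensive.

Import Order.TTheory GRing.Theory Num.Theory.

Local Open Scope ring_scope.

Section Dope.
Variable R : realType.

(* The 0/1 entries are encoded as booleans, true standing for 1. The
   columns are the derivative orders 0, ..., n, where n is the degree of P. *)
Definition dope_matrix (m n : nat) (P : {poly R[i]}) (L : m.-tuple R[i]) :
    'M[bool]_(m, n.+1) :=
  \matrix_(i < m, j < n.+1) ((P^`(j)).[tnth L i] == 0).

Definition dope_matrices (m n : nat) : {set 'M[bool]_(m, n.+1)} :=
  [set D : 'M[bool]_(m, n.+1) |
    `[< exists (P : {poly R[i]}) (L : m.-tuple R[i]),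
          [/\ size P = n.+1, uniq L & D = dope_matrix n P L] >]].

Definition log2 (x : R) : R := ln x / ln 2.

End Dope.

(* Main.v *)
(* By an affine change of variable and a rescaling, the first two nodes are 0
   and 1 and P is monic. The dope matrix then records which of the polynomials
   P^(j)(lambda_i), i <= m, j < n, vanish, as functions of the m + n - 2
   remaining nodes and coefficients. These have degree 1 at the nodes 0 and 1
   and degree n - j elsewhere, of total 2n + (m - 2) n (n + 1) / 2, and the
   Ronyai-Babai-Ganapathy bound on the number of zero patterns applies. *)
Require Import Defs.
From mathcomp Require Import all_boot all_order all_algebra.
From mathcomp Require Import complex reals sequences exp.
From mathcomp Require Import boolp zify.

Set Implicit Arguments.
Unset Strict Implicit.
Unset Printing Implicit Defensive.

Import Order.TTheory GRing.Theory Num.Theory.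

Local Open Scope ring_scope.

(** * Polynomial functions of bounded total degree in [k] variables, and their zero patterns *)

Section PolynomialFunctions.
Variables (F : fieldType) (k : nat).
Implicit Types (f g : ('I_k -> F) -> F) (d : nat).

(** A multivariate polynomial is a list of pairs (coefficient, exponent vector). Monomials may
    repeat, so that addition is concatenation and no normal form is required. *)
Definition degree_le d f := exists s : seq (F * {ffun 'I_k -> nat}),
  all (fun t : F * {ffun 'I_k -> nat} => (\sum_i t.2 i <= d)%N) s /\
  forall x, f x = \sum_(t <- s) t.1 * \prod_i x i ^+ t.2 i.

Lemma degree_le_ext d f g : f =1 g -> degree_le d f -> degree_le d g.
Proof. by move=> fg [s [sd fs]]; exists s; split=> // x; rewrite -fg fs. Qed.

Lemma degree_leW d e f : (d <= e)%N -> degree_le d f -> degree_le e f.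
Proof.
move=> de [s [/allP sd fs]]; exists s; split=> //.
by apply/allP => t /sd td; apply: leq_trans de.
Qed.

Lemma degree_le_const d (c : F) : degree_le d (fun=> c).
Proof.
exists [:: (c, [ffun=> 0%N])]; split=> [|x] /=.
  by rewrite andbT big1 // => i _; rewrite ffunE.
by rewrite big_seq1 /= big1 ?mulr1 // => i _; rewrite ffunE expr0.
Qed.

Lemma degree_le_var (i : 'I_k) : degree_le 1 (fun x => x i).
Proof.
exists [:: (1, [ffun j => (j == i) : nat])]; split=> [|x] /=.
  rewrite andbT (bigD1 i) //= ffunE eqxx big1 // => j /negPf ji.
  by rewrite ffunE ji.
rewrite big_seq1 mul1r (bigD1 i) //= ffunE eqxx big1 ?mulr1 // => j /negPf ji.
by rewrite ffunE ji.
Qed.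

Lemma degree_leD d f g : degree_le d f -> degree_le d g ->
  degree_le d (fun x => f x + g x).
Proof.
move=> [s [sd fs]] [r [rd gr]]; exists (s ++ r); split=> [|x].
  by rewrite all_cat sd.
by rewrite big_cat /= fs gr.
Qed.

Lemma degree_leM d e f g : degree_le d f -> degree_le e g ->
  degree_le (d + e) (fun x => f x * g x).
Proof.
move=> [s [/allP sd fs]] [r [/allP rd gr]].
pose mulm (t u : F * {ffun 'I_k -> nat}) :=
  (t.1 * u.1, [ffun i => (t.2 i + u.2 i)%N]).
exists [seq mulm t u | t <- s, u <- r].
split=> [|x].
  apply/allP => _ /allpairsP[[t u] /= [/sd td /rd ud ->]] /=.
  by under eq_bigr do rewrite ffunE; rewrite big_split leq_add.
rewrite big_allpairs_dep fs gr big_distrlr /=.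
apply: eq_bigr => t _; apply: eq_bigr => u _.
under [X in _ = _ * X]eq_bigr do rewrite ffunE exprD.
by rewrite big_split mulrACA.
Qed.

Lemma degree_le_sum d (I : Type) (r : seq I) (f : I -> ('I_k -> F) -> F) :
  (forall i, degree_le d (f i)) -> degree_le d (fun x => \sum_(i <- r) f i x).
Proof.
move=> fd; elim: r => [|i r IHr].
  by apply: degree_le_ext (degree_le_const d 0) => x; rewrite big_nil.
by apply: degree_le_ext (degree_leD (fd i) IHr) => x; rewrite big_cons.
Qed.

Lemma degree_le_prod (I : Type) (r : seq I) (P : pred I) (d : I -> nat)
    (f : I -> ('I_k -> F) -> F) :
  (forall i, degree_le (d i) (f i)) ->
  degree_le (\sum_(i <- r | P i) d i) (fun x => \prod_(i <- r | P i) f i x).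
Proof.
move=> fd; elim: r => [|i r IHr].
  rewrite big_nil.
  by apply: degree_le_ext (degree_le_const 0 1) => x; rewrite big_nil.
rewrite big_cons; case Pi: (P i).
  apply: degree_le_ext (degree_leM (fd i) IHr) => x.
  by rewrite big_cons Pi.
by apply: degree_le_ext IHr => x; rewrite big_cons Pi.
Qed.

Lemma degree_leX d f j : degree_le d f -> degree_le (d * j) (fun x => f x ^+ j).
Proof.
move=> fd; elim: j => [|j IHj].
  by apply: degree_le_const.
rewrite mulnS; apply: degree_le_ext (degree_leM fd IHj) => x.
by rewrite exprS.
Qed.

(** Evaluation at fixed points is linear, so the values of [f] combine the rows of the monomials.
    The tuples index the exponent vectors of total degree at most [d], which turns a rank into a
    count of monomials. *)
Lemma degree_le_span d f N (x : 'I_N -> 'I_k -> F) : degree_le d f ->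
  (\row_v f (x v) <=
   \matrix_(a < #|[set t : k.-tuple 'I_d.+1 | (\sum_(i <- t) i <= d)%N]|, v < N)
     \prod_i x v i ^+ tnth (enum_val a) i)%MS.
Proof.
set A := [set t : k.-tuple _ | _]; set B := (X in (_ <= X)%MS).
case=> s [/allP sd fs].
suff mon t : t \in s -> ((\row_v \prod_i x v i ^+ t.2 i : 'rV_N) <= B)%MS.
  have -> : \row_v f (x v) =
      \sum_(t <- s) t.1 *: (\row_v \prod_i x v i ^+ t.2 i : 'rV_N).
    apply/rowP => v; rewrite mxE fs summxE; apply: eq_bigr => t _.
    by rewrite !mxE.
  by rewrite big_seq; apply: summx_sub => t ts; apply/scalemx_sub/mon.
move=> ts; have td := sd t ts.
(* Each exponent is bounded by the total degree, so [inord] does not fall back to its default. *)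
have tE (i : 'I_k) : (inord (t.2 i) : 'I_d.+1) = t.2 i :> nat.
  by rewrite inordK // ltnS (leq_trans _ td) // (bigD1 i) //= leq_addr.
pose u : k.-tuple 'I_d.+1 := [tuple inord (t.2 i) | i < k].
have uA : u \in A.
  rewrite inE big_tuple (leq_trans _ td) //.
  by apply: leq_sum => i _; rewrite tnth_mktuple tE.
have -> : (\row_v \prod_i x v i ^+ t.2 i : 'rV_N) = row (enum_rank_in uA u) B.
  apply/rowP => v; rewrite !mxE enum_rankK_in //.
  by apply: eq_bigr => i _; rewrite tnth_mktuple tE.
exact: row_sub.
Qed.

(* A pattern w is the set of j with f_j != 0. Each w is realised at some x_w;
   the product g_w of the f_j not vanishing at x_w satisfies g_w(x_v) != 0 iff w \subset v, so the matrix
   (g_w(x_v)) is triangular and the g_w are linearly independent. *)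
Lemma zero_pattern_bound (J : finType) (d : J -> nat)
    (f : J -> ('I_k -> F) -> F) (W : {set {set J}}) :
    (forall j, degree_le (d j) (f j)) ->
    (forall w, w \in W -> exists x, w = [set j | f j x != 0]) ->
  (#|W| <= 'C(k + \sum_j d j, k))%N.
Proof.
move=> fd Wx; set D := (\sum_j d j)%N.
have /fin_all_exists[x xP] (a : 'I_#|W|) :
    exists x, enum_val a = [set j | f j x != 0].
  exact/Wx/enum_valP.
pose g (a : 'I_#|W|) y := \prod_(j in enum_val a) f j y.
have gd a : degree_le D (g a).
  apply: degree_leW (degree_le_prod (index_enum J) (mem (enum_val a)) fd).
  by rewrite /D [leqRHS](bigID (mem (enum_val a))) leq_addr.
have gP a b : (g a (x b) != 0) = (enum_val a \subset enum_val b).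
  apply/idP/subsetP => [/prodf_neq0 nz j ja|sub].
    by rewrite xP inE nz.
  by apply/prodf_neq0 => j /sub; rewrite xP inE.
pose G := \matrix_(a < #|W|) \row_b g a (x b).
have freeG : row_free G.
  apply: inj_row_free => u uG0; apply/rowP => a0; rewrite mxE.
  apply/eqP/negPn/negP => ua0.
  (* Choose [b] of least cardinality in a vanishing combination. At [x b] any other surviving term
     has its set inside that of [b], hence equal to it by minimality; only the diagonal term is
     left. *)
  have [b ub bmin] : exists2 b, u ord0 b != 0 &
      forall c, u ord0 c != 0 -> (#|enum_val b| <= #|enum_val c|)%N.
    have [b ub bmin] := arg_minnP (P := fun b => u ord0 b != 0)
      (fun b : 'I_#|W| => #|enum_val b|) ua0.
    by exists b.
  have := congr1 (fun M : 'rV_ _ => M ord0 b) uG0.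
  rewrite !mxE (bigD1 b) //= big1 => [|c cb].
    rewrite addr0 !mxE => /eqP; rewrite mulf_eq0 (negPf ub) /=.
    by apply/negP; rewrite gP.
  apply/eqP; rewrite !mxE mulf_eq0; case: eqP => //= /eqP uc.
  rewrite -[_ == 0]negbK gP; apply/negP => scb; case/negP: cb.
  by rewrite -(inj_eq enum_val_inj) eqEcard scb bmin.
(* The rank of [G] is the number of patterns; its rows lie in a span of 'C(k + D, k) monomial
   rows. *)
rewrite -[leqLHS](eqP freeG) -card_partial_ord_partitions.
have sub a := degree_le_span x (gd a).
apply: leq_trans (mxrankS _) (rank_leq_row _).
by apply/row_subP => a; rewrite rowK; apply: sub.
Qed.

End PolynomialFunctions.

(** * Normalisation to a monic polynomial with nodes 0 and 1, and degrees of the entries *)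

Section NormalisedPolynomials.
Variables (F : numFieldType) (m n : nat).

Lemma derivn_comp_affine (p : {poly F}) (a b : F) j :
  (p \Po (b *: 'X + a%:P))^`(j) = b ^+ j *: (p^`(j) \Po (b *: 'X + a%:P)).
Proof.
elim: j => [|j IHj]; first by rewrite !derivn0 expr0 scale1r.
rewrite !derivnS IHj derivZ deriv_comp derivD derivC addr0 derivZ derivX.
by rewrite -scalerAr mulr1 scalerA -exprSr.
Qed.

(* A point x of F^(m + n) lists the nodes of index >= 2, then the non-leading
   coefficients; nodes 0 and 1 are frozen at 0 and 1. *)
Definition normal_node (x : 'I_(m + n) -> F) (i : 'I_(2 + m)) : F :=
  match split i with inl e => e%:R | inr i' => x (lshift n i') end.

Definition normal_poly (x : 'I_(m + n) -> F) : {poly F} :=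
  'X^n + \sum_(l < n) x (rshift m l) *: 'X^l.

Definition normal_entry (ij : 'I_(2 + m) * 'I_n) (x : 'I_(m + n) -> F) : F :=
  ((normal_poly x)^`(ij.2)).[normal_node x ij.1].

Definition normal_degree (ij : 'I_(2 + m) * 'I_n) : nat :=
  if split ij.1 is inl _ then 1 else n - ij.2.

Lemma normal_entryE ij x : normal_entry ij x =
  normal_node x ij.1 ^+ (n - ij.2) * (n ^_ ij.2)%:R +
  \sum_(l < n) x (rshift m l) *
    (normal_node x ij.1 ^+ (l - ij.2) * (l ^_ ij.2)%:R).
Proof.
rewrite /normal_entry /normal_poly derivnD linear_sum /= hornerD horner_sum.
congr (_ + _); first by rewrite derivnXn hornerMn hornerXn mulr_natr.
by apply: eq_bigr => l _; rewrite derivnZ derivnXn hornerZ hornerMn hornerXn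
  mulr_natr.
Qed.

Lemma normal_entry_degree ij : degree_le (normal_degree ij) (normal_entry ij).
Proof.
apply: (degree_le_ext (fun x => esym (normal_entryE ij x))).
case: ij => i j; rewrite /normal_degree /normal_node /=; have jn := ltn_ord j.
(* Used with [e] = 0 at a frozen node, where [y] is constant, and [e] = 1 at a free one. *)
have varX e d (y : ('I_(m + n) -> F) -> F) c :
    degree_le e y -> (e * d <= c)%N ->
    forall q : F, degree_le c (fun x => y x ^+ d * q).
  move=> yd cd q; apply: degree_leW (degree_leM (degree_leX d yd)
    (degree_le_const _ 0 q)).
  by rewrite addn0.
case: (split i) => [e|i'].
- apply: degree_leD.
    by apply: (varX 0%N); [apply: degree_le_const | rewrite mul0n].
  apply: degree_le_sum => l; apply: (degree_leM (d := 1) (e := 0)).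
    exact: degree_le_var.
  by apply: (varX 0%N); [apply: degree_le_const | rewrite mul0n].
- apply: degree_leD.
    by apply: (varX 1%N); [apply: degree_le_var | rewrite mul1n].
  apply: degree_le_sum => l; have ln := ltn_ord l; case: (ltnP l j) => lj.
    apply: degree_le_ext (degree_le_const _ _ 0) => x.
    by rewrite ffact_small // !mulr0.
  have -> : (n - j = 1 + (n - j).-1)%N by lia.
  apply: degree_leM; first exact: degree_le_var.
  by apply: (varX 1%N); [apply: degree_le_var | lia].
Qed.

Lemma sum_normal_degree :
  (\sum_ij normal_degree ij = 2 * n + (m * n * (n + 1)) %/ 2)%N.
Proof.
(* Stated doubled to keep the induction free of division; it also shows that the final halving is
   exact. *)
have sumE : ((\sum_(j < n) (n - j)) * 2 = n * (n + 1))%N.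
  elim: (n) => [|p IHp]; first by rewrite big_ord0.
  rewrite big_ord_recl /= subn0.
  under eq_bigr do rewrite /bump /= add1n subSS.
  by rewrite mulnDl IHp; lia.
rewrite -(pair_bigA _ (fun i j => normal_degree (i, j))) big_split_ord /=.
rewrite /normal_degree /=; congr (_ + _)%N.
  under eq_bigr do under eq_bigr do rewrite (unsplitK (inl _ _)).
  by rewrite !sum_nat_const !card_ord muln1.
under eq_bigr do under eq_bigr do rewrite (unsplitK (inr _ _)).
by rewrite sum_nat_const card_ord -mulnA -sumE mulnA mulnK.
Qed.

(** Substituting a + bX multiplies the [j]-th derivative by b^j, and dividing by the leading
    coefficient rescales it; both factors are nonzero, so the zeros are preserved. *)
Lemma normal_form (P : {poly F}) (L : 'I_(2 + m) -> F) :
    size P = n.+1 -> injective L ->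
  exists x, forall ij : 'I_(2 + m) * 'I_n,
    ((P^`(ij.2)).[L ij.1] == 0) = (normal_entry ij x == 0).
Proof.
move=> sizeP injL.
(* The map y -> a + by sends 0 and 1 to the first two nodes. *)
pose a := L (lshift m ord0); pose b := L (lshift m ord_max) - a.
have b0 : b != 0 by rewrite subr_eq0 (inj_eq injL) (inj_eq (@lshift_inj _ _)).
pose A : {poly F} := b *: 'X + a%:P.
pose Q := P \Po A.
have sizeA : size A = 2.
  by rewrite /A size_addl size_scale ?size_polyX // size_polyC; case: eqP.
have sizeQ : size Q = n.+1.
  by rewrite /Q size_comp_poly2 // sizeP.
pose c := lead_coef Q.
have c0 : c != 0 by rewrite lead_coef_eq0 -size_poly_eq0 sizeQ.
pose x (v : 'I_(m + n)) := match split v with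
  | inl i => (L (rshift 2 i) - a) / b
  | inr l => c^-1 * Q`_l
  end.
have polyE : normal_poly x = c^-1 *: Q.
  rewrite -[in RHS](coefK Q) sizeQ poly_def big_ord_recr /= scalerDr addrC.
  rewrite /normal_poly; congr (_ + _).
    by rewrite scalerA -[X in Q`_X]/(n.+1.-1) -sizeQ mulVf // scale1r.
  rewrite scaler_sumr; apply: eq_bigr => l _.
  by rewrite /x (unsplitK (inr _ _)) scalerA.
have nodeE i : b * normal_node x i + a = L i.
  rewrite /normal_node -[i in RHS]splitK; case: (split i) => [e|i'] /=.
    case: e => -[|[|//]] ie /=.
      by rewrite mulr0 add0r; congr (L (lshift _ _)); apply: val_inj.
    by rewrite mulr1 subrK; congr (L (lshift _ _)); apply: val_inj.
  by rewrite /x (unsplitK (inl _ _)) mulrC divfK // subrK.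
exists x => -[i j]; rewrite /normal_entry /= polyE derivnZ derivn_comp_affine.
rewrite !hornerZ horner_comp !hornerE nodeE.
by rewrite !mulf_eq0 invr_eq0 (negPf c0) expf_eq0 (negPf b0) andbF.
Qed.

End NormalisedPolynomials.

(** * From dope matrices to zero patterns *)

(** The [n]-th derivative is the constant n! times the leading coefficient, nonzero in
    characteristic 0. Hence the last column of a dope matrix is always [false]. *)
Lemma derivn_top_neq0 (F : numFieldType) (P : {poly F}) n (y : F) :
  size P = n.+1 -> (P^`(n)).[y] != 0.
Proof.
move=> sizeP; have Pn : P`_n != 0.
  by rewrite -[n]/(n.+1.-1) -sizeP lead_coef_eq0 -size_poly_eq0 sizeP.
have -> : P^`(n) = (P`_n *+ n`!)%:P.
  apply/polyP => i; rewrite coef_derivn coefC; case: i => [|i] /=.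
    by rewrite addn0 ffactnn.
  by rewrite nth_default ?mul0rn // sizeP; lia.
by rewrite hornerC mulrn_eq0 negb_or -lt0n fact_gt0.
Qed.

Lemma card_dope_matrices (R : realType) m n :
  (#|dope_matrices R m.+2 n| <=
   'C(m + n + (2 * n + (m * n * (n + 1)) %/ 2), m + n))%N.
Proof.
(* The last column is dropped, being constant; negation selects the nonvanishing entries, as
   [zero_pattern_bound] expects. *)
pose pattern (D : 'M[bool]_(m.+2, n.+1)) : {set 'I_(2 + m) * 'I_n} :=
  [set ij | ~~ D ij.1 (widen_ord (leqnSn n) ij.2)].
have pattern_inj : {in dope_matrices R m.+2 n &, injective pattern}.
  have last D i : D \in dope_matrices R m.+2 n -> D i ord_max = false.
    rewrite inE => /asboolP[P [L [sizeP _ ->]]]; rewrite mxE.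
    exact/negbTE/derivn_top_neq0.
  move=> D D' DM DM' eqD; apply/matrixP => i j.
  case: (unliftP ord_max j) => [j'|] ->; last by rewrite !last.
  have /setP/(_ (i, j')) := eqD; rewrite !inE /= => /negb_inj.
  by have -> : widen_ord (leqnSn n) j' = lift ord_max j' by
    apply: val_inj; rewrite /= /bump leqNgt ltn_ord.
rewrite -(card_in_imset pattern_inj) -sum_normal_degree.
apply: (zero_pattern_bound (f := @normal_entry R[i] m n)) => [ij|w /imsetP[D]].
  exact: normal_entry_degree.
rewrite inE => /asboolP[P [L [sizeP uniqL ->]]] ->.
have [x xP] := normal_form sizeP (tuple_uniqP L uniqL).
by exists x; apply/setP => ij; rewrite !inE mxE -xP.
Qed.

(** * Binomial estimates and the three inequalities *)

Lemma leq_bin_succ n k : ('C(n, k) <= 'C(n.+1, k.+1))%N.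
Proof. by rewrite binS leq_addl. Qed.

(** The bound 'C(N, k) <= (eN/k)^k cleared of its denominator, from 'C(N, k) k! <= N^k and k^k <=
    e^k k!. *)
Lemma bin_le_expR (R : realType) (N k : nat) :
  'C(N, k)%:R * k%:R ^+ k <= (expR 1 * N%:R) ^+ k :> R.
Proof.
case: k => [|k]; first by rewrite bin0 !expr0 mulr1.
have binN : 'C(N, k.+1)%:R * (k.+1)`!%:R <= N%:R ^+ k.+1 :> R.
  rewrite -natrM bin_ffact -natrX ler_nat.
  elim: (k.+1) => [|p IHp]; first by rewrite ffactn0.
  by rewrite ffactnSr expnSr leq_mul // leq_subr.
(* k^k / k! is a single term of the exponential series at [k]. *)
have facte : k.+1%:R ^+ k.+1 <= expR 1 ^+ k.+1 * (k.+1)`!%:R :> R.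
  have := expR_ge1Dxn k (ler0n R k.+1).
  rewrite -[X in expR X]mulr1 expRM_natl => le_e.
  rewrite -ler_pdivrMr ?ltr0n ?fact_gt0 //; apply: le_trans le_e.
  by rewrite lerDr.
rewrite exprMn; apply: le_trans (ler_wpM2l _ facte) _ => //.
by rewrite mulrCA ler_wpM2l ?exprn_ge0 ?expR_ge0.
Qed.

Theorem theorem1p4 (R : realType) (m n : nat) (hm : (3 <= m)%N) (hn : (2 <= n)%N) :
  [/\ (#|dope_matrices R m n|
         <= 'C(3 * n + m - 2 + ((m - 2) * n * (n + 1)) %/ 2, m + n - 2))%N,
      ('C(3 * n + m - 2 + ((m - 2) * n * (n + 1)) %/ 2, m + n - 2)
         <= 'C(m * n ^ 2, m + n))%N
    & 'C(m * n ^ 2, m + n)%:R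
         <= 2 `^ ((m + n)%:R * log2 (expR 1 * m%:R * n%:R)) :> R].
Proof.
split.
- case: m hm => [|[|m]] // _.
  have := card_dope_matrices R m n.
  rewrite (_ : m.+2 - 2 = m)%N; last lia.
  rewrite (_ : m.+2 + n - 2 = m + n)%N; last lia.
  by rewrite (_ : 3 * n + m.+2 - 2 = m + n + 2 * n)%N ?addnA; last lia.
- apply: leq_trans (leq_trans (leq_bin_succ _ _) (leq_bin_succ _ _)) _.
  rewrite (_ : (m + n - 2).+2 = m + n)%N; last lia.
  apply: leq_bin2l.
  have : (((m - 2) * n * (n + 1)) %/ 2 * 2 <= (m - 2) * n * (n + 1))%N.
    exact: leq_trunc_div.
  (* With the truncated subtractions removed, the upper indices are compared knowing only that twice
     the quotient is at most (m - 2)n(n + 1). For n = 2 the two upper indices are equal. *)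
  have [p ->] : exists p, m = p.+2 by exists (m - 2)%N; lia.
  have [q ->] : exists q, n = q.+2 by exists (n - 2)%N; lia.
  rewrite (_ : p.+2 - 2 = p)%N; last lia.
  rewrite (_ : 3 * q.+2 + p.+2 - 2 = 3 * q + 6 + p)%N; last lia.
  move: (_ %/ 2)%N => T; rewrite -(leq_pmul2r (isT : 0 < 2)%N) => T2.
  nia.
- set k := (m + n)%N; set y : R := expR 1 * m%:R * n%:R.
  have k0 : (0 < k)%N by rewrite /k; lia.
  have y0 : 0 < y by rewrite !mulr_gt0 ?expR_gt0 ?ltr0n //; lia.
  have -> : 2 `^ (k%:R * log2 y) = y ^+ k.
    rewrite mulrC powRrM powR_mulrn ?powR_ge0 //; congr (_ ^+ _).
    rewrite /powR pnatr_eq0 /= /log2 divfK ?lnK ?posrE //.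
    by rewrite gt_eqF // ln_gt0 // ltr1n.
  have kk : 0 < k%:R ^+ k :> R by rewrite exprn_gt0 ?ltr0n.
  rewrite -(ler_pM2r kk); apply: le_trans (bin_le_expR _ _ _) _.
  rewrite -exprMn lerXn2r ?nnegrE ?mulr_ge0 ?expR_ge0 ?ler0n //.
  rewrite natrM natrX expr2 /y -!mulrA.
  (* Cancelling e, m and n from e m n^2 <= e m n (m + n) leaves n <= m + n. *)
  do 3![apply: ler_wpM2l; first by rewrite ?expR_ge0].
  by rewrite ler_nat leq_addl.
Qed.
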